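(* In the restricted-placement SOS game, the first player wins.
   Context: Restricted-placement SOS game: the board is a $3\times 3$ grid with rows and columns numbered $1,2,3$, initially empty. Two players alternately write either an S or an O in an empty cell. The first player may make the first move in any cell. Every subsequent move must be made in the row corresponding to the previous move's column: if the previous letter was placed in column $j$, the next player must play in an empty cell of row $j$. A player may be unable to move although there are empty cells on the board (when the required row is completely filled); in that case the game ends with no winner. The first player whose move produces SOS in three consecutive cells of a row, column, or diagonal wins (no matter who wrote the individual letters). Both players are assumed to play optimally: ''the first player wins'' means that the first player has a winning strategy. *)

(* Defs.v *)
From HB Require Import structures.
From mathcomp Require Import all_boot all_order all_algebra.

Set Implicit Arguments.
Unset Strict Implicit.
Unset Printing Implicit Defensive.

Inductive letter := letS | letO.

Definition is_letS (l : letter) : bool := if l is letS then true else false.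
Definition letter_of_bool (b : bool) : letter := if b then letS else letO.
Lemma is_letSK : cancel is_letS letter_of_bool.
Proof. by case. Qed.
HB.instance Definition _ := Equality.copy letter (can_type is_letSK).

(* [B i j] is the content of the cell in row [i] and column [j]; [None] is an
   empty cell. Rows and columns are numbered 0, 1, 2 instead of 1, 2, 3. *)
Definition board := 'M[option letter]_3.

Record move := Move { mrow : 'I_3; mcol : 'I_3; mletter : letter }.

Definition put (B : board) (m : move) : board :=
  (\matrix_(i, j) if (i == mrow m) && (j == mcol m) then Some (mletter m)
                  else B i j)%R.

(* A history is the list of the moves made so far, oldest first; the moves at
   the even positions 0, 2, ... are those of the first player. *)
Definition history := seq move.

Definition board_after (h : history) : board := foldl put (const_mx None) h.

Definition reads_SOS (w : 'I_3 -> option letter) : bool :=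
  [seq w k | k <- enum 'I_3] == [:: Some letS; Some letO; Some letS].

(* In a 3 x 3 grid, three consecutive cells of a row, column or diagonal are
   a full row, a full column or one of the two main diagonals. *)
Definition has_SOS (B : board) : bool :=
  [|| [exists i, reads_SOS (fun k => B i k)],
      [exists j, reads_SOS (fun k => B k j)],
      reads_SOS (fun k => B k k) |
      reads_SOS (fun k => B k (rev_ord k))].

Definition allowed_row (h : history) (i : 'I_3) : bool :=
  if h is m :: h' then i == mcol (last m h') else true.

(* The game stops as soon as SOS has been produced, hence the last clause. *)
Definition legal (h : history) (m : move) : bool :=
  [&& board_after h (mrow m) (mcol m) == None,
      allowed_row h (mrow m) &
      ~~ has_SOS (board_after h)].

Inductive is_play : history -> Prop :=
| play_nil : is_play [::]
| play_rcons h m : is_play h -> legal h m -> is_play (rcons h m).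

(* No legal move: either SOS has been produced or the required row is full. *)
Definition game_over (h : history) : Prop := forall m, ~~ legal h m.

(* For a play [h], SOS can only have been produced by the last move of [h],
   and the first player made that move when the number of moves is odd. *)
Definition won_by_first (h : history) : bool :=
  has_SOS (board_after h) && odd (size h).

(* Only the values at histories of even length (the first player to move)
   matter. *)
Definition strategy := history -> move.

Definition first_follows (s : strategy) (h : history) : Prop :=
  forall h1 m h2, h = h1 ++ m :: h2 -> ~~ odd (size h1) -> m = s h1.

Definition first_winning_strategy (s : strategy) : Prop :=
  forall h, is_play h -> first_follows s h ->
    (game_over h -> won_by_first h) /\
    (~ game_over h -> ~~ odd (size h) -> legal h (s h)).

Definition first_player_wins : Prop := exists s, first_winning_strategy s.

(* Main.v *)
Require Import Defs.
From mathcomp Require Import all_boot all_order all_algebra.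

Set Implicit Arguments.
Unset Strict Implicit.
Unset Printing Implicit Defensive.

(** The first player opens with an O in the centre and wins at the fifth move
    at the latest, always by completing a line through the centre: such a line
    needs only an S at each of two opposite cells.

    The opponent must answer in the middle row, at one of its two ends; let [c]
    be the column of that cell.
    - If the answer is an O, the first player writes an S in column 1 of row
      [c].  This sends the opponent back to the middle row, whose only empty
      cell is in column [2 - c]; the first player is then sent to the row
      opposite to row [c] and completes the middle column.
    - If the answer is an S, the first player writes an S in the corner
      [(c, c)], so the opponent must play in one of the other two cells of row
      [c].  Column 1 sends the first player to the middle row, completed by an S
      facing the opponent's first S.  Column [2 - c] sends the first player
      to the row [2 - c], where an S in the corner [(2 - c, 2 - c)] completes a
      diagonal.
    In no case does the opponent complete SOS or leave the first player in a
    full row.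

    [forced_win_winning] reduces the claim to [forced_win], an inductive
    predicate on the positions that the strategy meets, and [forced_win_nil]
    goes through the positions above. *)

Definition mid : 'I_3 := Ordinal (isT : 1 < 3).

(** * From forced wins to winning strategies *)

(** The second constructor asks for a legal reply, because a move after which
    the opponent is stuck ends the game without a winner.  A reply completing
    SOS is excluded by the legality of the next move of [s]. *)
Inductive forced_win (s : strategy) (h : history) : Prop :=
| win_now of legal h (s h) & has_SOS (board_after (rcons h (s h)))
| win_later of legal h (s h)
    & (exists m, legal (rcons h (s h)) m)
    & (forall m, legal (rcons h (s h)) m ->
         forced_win s (rcons (rcons h (s h)) m)).

Lemma forced_win_legal s h : forced_win s h -> legal h (s h).
Proof. by case. Qed.

Lemma first_follows_rcons s h m :
  first_follows s (rcons h m) ->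
  first_follows s h /\ (~~ odd (size h) -> m = s h).
Proof.
move=> fol; split=> [h1 m1 h2 eq_h|]; last by apply: (fol h m [::]); rewrite cats1.
by apply: (fol h1 m1 (rcons h2 m)); rewrite eq_h rcons_cat rcons_cons.
Qed.

(** This is the invariant that makes the induction on plays go through: at odd
    length it remembers the position from which [s] has just moved. *)
Lemma forced_win_play s h :
  forced_win s [::] -> is_play h -> first_follows s h ->
  if odd (size h) then exists2 h', h = rcons h' (s h') & forced_win s h'
  else forced_win s h.
Proof.
move=> win0; elim=> [//|{}h m _ IHh legal_hm] /first_follows_rcons[fol m_eq].
rewrite size_rcons /=; move: (IHh fol) m_eq; case: (odd (size h)) => /=.
  case=> h' eq_h [_ sos|_ _ win] _; last by rewrite eq_h; apply: win; rewrite -eq_h.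
  by move: legal_hm; rewrite eq_h /legal sos !andbF.
by move=> win ->//; exists h.
Qed.

Lemma forced_win_winning s : forced_win s [::] -> first_winning_strategy s.
Proof.
move=> win0 h play fol; have := forced_win_play win0 play fol.
rewrite /won_by_first; case: (boolP (odd (size h))) => [odd_h | _].
  case=> h' eq_h win; split=> // over; rewrite andbT.
  case: win => [_|_ [m legal_m] _]; first by rewrite eq_h.
  by move: (over m); rewrite eq_h legal_m.
move=> /forced_win_legal legal_s; split=> // over.
by move: (over (s h)); rewrite legal_s.
Qed.

(** * Evaluating positions *)

(** The matrices and enumerations behind [legal] do not reduce; [cell] and [sos]
    are computable counterparts, so that concrete positions are settled by
    evaluation. *)
Definition cell (h : history) (i j : 'I_3) : option letter :=
  foldl (fun x m => if (i == mrow m) && (j == mcol m) then Some (mletter m)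
                    else x) None h.

Lemma board_afterE h i j : board_after h i j = cell h i j.
Proof.
elim/last_ind: h => [|h m IHh]; first by rewrite mxE.
by rewrite /board_after /cell !foldl_rcons mxE IHh.
Qed.

Definition reads (w : 'I_3 -> option letter) : bool :=
  [&& w ord0 == Some letS, w mid == Some letO & w ord_max == Some letS].

Lemma enum_I3 : enum 'I_3 = [:: ord0; mid; ord_max].
Proof. by apply: (inj_map val_inj); rewrite val_enum_ord. Qed.

Lemma reads_SOSE w : reads_SOS w = reads w.
Proof. by rewrite /reads_SOS enum_I3 /= !eqseq_cons andbT. Qed.

Lemma exists_I3 (P : pred 'I_3) :
  [exists i, P i] = [|| P ord0, P mid | P ord_max].
Proof.
apply/existsP/idP=> [[i]|].
  have: i \in enum 'I_3 by rewrite mem_enum.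
  by rewrite enum_I3 !inE => /or3P[]/eqP-> ->; rewrite ?orbT.
by case/or3P=> Pi; eexists; exact: Pi.
Qed.

Definition sos (b : 'I_3 -> 'I_3 -> option letter) : bool :=
  [|| reads (b ord0), reads (b mid), reads (b ord_max),
      reads (b^~ ord0), reads (b^~ mid), reads (b^~ ord_max),
      reads (fun k => b k k) | reads (fun k => b k (rev_ord k))].

Lemma has_SOSE h : has_SOS (board_after h) = sos (cell h).
Proof.
rewrite /has_SOS /sos !exists_I3 !reads_SOSE /reads !board_afterE.
by rewrite -!orbA.
Qed.

Lemma legalE h m :
  legal h m = [&& cell h (mrow m) (mcol m) == None, allowed_row h (mrow m)
                & ~~ sos (cell h)].
Proof. by rewrite /legal board_afterE has_SOSE. Qed.

(** * The strategy *)

(** With an O in the centre, an S written in this column of row [i] completes a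
    line.  Several columns may qualify when the last letter is an S in a corner,
    and then either diagonal will do.  The default [ord0] is never reached in
    the plays that follow the strategy. *)
Definition completing_col (h : history) (i : 'I_3) : 'I_3 :=
  head ord0 [seq k <- [:: ord0; mid; ord_max] |
    (cell h i k == None) && (cell h (rev_ord i) (rev_ord k) == Some letS)].

Definition central_strategy : strategy := fun h =>
  match h with
  | [::] => Move mid mid letO
  | [:: _; m] =>
      Move (mcol m) (if mletter m == letS then mcol m else mid) letS
  | m :: h' =>
      let i := mcol (last m h') in Move i (completing_col h i) letS
  end.

(* One goal for each legal next move, the illegal ones being refuted. *)
Ltac each_legal_move :=
  case=> [[[|[|[|//]]] ?] [[|[|[|//]]] ?] []]; rewrite legalE;
  try (by vm_compute); move=> _.

(** Once the opponent's first answer is known, at most four replies are legal to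
    the first player's second move, and each loses at once. *)
Ltac win_by_third_move reply :=
  apply: win_later; [by rewrite legalE | by exists reply; rewrite legalE |];
  each_legal_move;
  (by apply: win_now; [rewrite legalE | rewrite has_SOSE]; vm_compute).

Lemma forced_win_nil : forced_win central_strategy [::].
Proof.
apply: win_later; first by rewrite legalE.
  by exists (Move mid ord0 letS); rewrite legalE.
(* The opponent's answers: an S or an O on the left, an S or an O on the
   right. *)
each_legal_move.
- by win_by_third_move (Move ord0 mid letS).
- by win_by_third_move (Move mid ord_max letS).
- by win_by_third_move (Move ord_max mid letS).
- by win_by_third_move (Move mid ord0 letS).
Qed.

Theorem theorem14 : first_player_wins.
Proof.
by exists central_strategy; apply/forced_win_winning/forced_win_nil.
Qed.
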